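(* Let $0\le a<b<\infty$, and let $f:[a,b]\to[0,\infty)$ be continuous on $[a,b]$ with $f\in L[a,b]$. Let $s\in(0,1]$ and $p,q>0$ be fixed. If $f$ is $s$-convex in the second sense on $[a,b]$, then $$\int_a^b (x-a)^p(b-x)^q f(x)f(a+b-x)\,dx \le \frac{(b-a)^{p+q+1}}{2}\Big\{\big(f^2(a)+f^2(b)\big)\big[\beta(p+1,2s+q+1)+\beta(q+1,2s+p+1)\big]+4f(a)f(b)\,\beta(p+s+1,q+s+1)\Big\}.$$
   Context: For $s\in(0,1]$, a function $f$ on $[a,b]\subset[0,\infty)$ is $s$-convex in the second sense if $f(\alpha u+\gamma v)\le \alpha^s f(u)+\gamma^s f(v)$ for all $u,v\in[a,b]$ and all $\alpha,\gamma\ge 0$ with $\alpha+\gamma=1$. $\beta(m,n)=\int_0^1 t^{m-1}(1-t)^{n-1}\,dt$ for $m,n>0$ is the Euler Beta function. $f^2(x)$ denotes $(f(x))^2$. $L[a,b]$ denotes the integrable functions on $[a,b]$. *)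

(* Defs.v *)
From mathcomp Require Import all_boot all_order all_algebra.
From mathcomp Require Import all_classical all_reals all_analysis.

Set Implicit Arguments.
Unset Strict Implicit.
Unset Printing Implicit Defensive.

Import Order.TTheory GRing.Theory Num.Theory.
Import numFieldNormedType.Exports.

Local Open Scope classical_set_scope.
Local Open Scope ring_scope.

(* Meant for 0 < s <= 1 and 0 <= a. The weights alpha, gamma may vanish:
   0 `^ s = 0 for s != 0, as expected. *)
Definition s_convex2 (R : realType) (s a b : R) (f : R -> R) : Prop :=
  forall u v alpha gamma : R, u \in `[a, b] -> v \in `[a, b] ->
    0 <= alpha -> 0 <= gamma -> alpha + gamma = 1 ->
    f (alpha * u + gamma * v) <= alpha `^ s * f u + gamma `^ s * f v.

(* The library's beta_fun only takes natural-number arguments. Meant for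
   0 < m and 0 < n, where the integrand is Lebesgue integrable; when m < 1 or
   n < 1, powR returns 0 at the singular endpoint, which is negligible. *)
Definition euler_beta (R : realType) (m n : R) : R :=
  \int[lebesgue_measure]_(t in `[0%R, 1%R]) (t `^ (m - 1) * (1 - t) `^ (n - 1)).

(* Main.v *)
(** Put x = a + (b - a) t. By s-convexity f(x) <= (1-t)^s f(a) + t^s f(b) and
    f(a + b - x) <= t^s f(a) + (1-t)^s f(b); bounding the product of the right-hand
    sides by half the sum of their squares leaves only monomials in t and 1 - t,
    whose integrals against t^p (1-t)^q are Beta values. *)

Require Import Defs.
From mathcomp Require Import all_boot all_order all_algebra.
From mathcomp Require Import all_classical all_reals all_analysis.
From mathcomp Require Import measurable_realfun ring lra.

Import Order.TTheory GRing.Theory Num.Theory.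
Import numFieldNormedType.Exports.
Local Open Scope classical_set_scope.
Local Open Scope ring_scope.

(** The absolute value is essential: [powR] is 1 at negative bases, so the bare power jumps at 0.
    Away from 0 continuity follows from differentiability; at 0 it needs a direct estimate. *)
Lemma continuous_norm_powR {R : realType} (p : R) : 0 < p ->
  continuous (fun t : R => `|t| `^ p).
Proof.
move=> p0 t; have [->|t0] := eqVneq t 0.
  apply/cvgrPdist_lt => e e0; near=> u.
  rewrite normr0 powR0 ?gt_eqF// sub0r normrN ger0_norm ?powR_ge0//.
  have -> : e = (e `^ p^-1) `^ p.
    by rewrite -powRrM mulVf ?gt_eqF// powRr1// ltW.
  rewrite gt0_ltr_powR ?nnegrE ?powR_ge0// -[u]subr0 distrC.
  by near: u; apply: cvgr_dist_lt; [exact: cvg_id|exact: powR_gt0].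
apply: (continuous_comp (f := fun u : R => `|u|) (g := fun u : R => u `^ p)).
  exact: norm_continuous.
apply/differentiable_continuous/derivable1_diffP/derivable_powR.
by rewrite in_itv/= andbT normr_gt0.
Unshelve. all: by end_near. Qed.

(* The absolute values make the kernel continuous on the whole line, while it is
   the Beta integrand on [0, 1]. *)
Definition beta_kernel {R : realType} (m n t : R) : R :=
  `|t| `^ m * `|1 - t| `^ n.

Lemma beta_kernel_continuous {R : realType} (m n : R) : 0 < m -> 0 < n ->
  continuous (beta_kernel m n).
Proof.
move=> m0 n0 t; apply: cvgM; first exact: continuous_norm_powR.
apply: (continuous_comp (f := fun u : R => 1 - u)
  (g := fun u : R => `|u| `^ n)); last exact: continuous_norm_powR.
by apply: cvgB; [exact: cvg_cst|exact: cvg_id].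
Qed.

Lemma beta_kernelE {R : realType} (m n t : R) : t \in `[0, 1] ->
  beta_kernel m n t = t `^ m * (1 - t) `^ n.
Proof.
by rewrite in_itv/= => /andP[t0 t1]; rewrite /beta_kernel !ger0_norm ?subr_ge0.
Qed.

Lemma Rintegral_beta_kernel {R : realType} (m n : R) :
  \int[lebesgue_measure]_(t in `[0, 1]) beta_kernel m n t =
  euler_beta (m + 1) (n + 1).
Proof.
apply: eq_Rintegral => t /set_mem t01.
by rewrite beta_kernelE// !addrK.
Qed.

(** The substitution of [1 - t] for [t] swaps the two factors. Arguments above 1 give positive
    exponents, hence a continuous kernel, as the substitution rule requires. *)
Lemma euler_betaC {R : realType} (m n : R) : 1 < m -> 1 < n ->
  euler_beta m n = euler_beta n m.
Proof.
move=> m1 n1.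
rewrite -(subrK 1 m) -(subrK 1 n) -!Rintegral_beta_kernel.
rewrite Rintegration_by_substitution_onem ?lexx ?ler01//; last first.
  by apply/continuous_subspaceT/beta_kernel_continuous; rewrite subr_gt0.
rewrite unstable.onem1; apply: eq_Rintegral => t _.
by rewrite /beta_kernel /unstable.onem subKr mulrC.
Qed.

Lemma continuous_itv_integrable {R : realType} (a b : R) (H : R -> R) :
  continuous H -> (@lebesgue_measure R).-integrable `[a, b] (EFin \o H).
Proof.
move=> cH; apply: continuous_compact_integrable; first exact: segment_compact.
exact: continuous_subspaceT.
Qed.

Lemma continuous_rescale {R : realType} (a b : R) (H : R -> R) :
  continuous H -> continuous (fun x => H ((x - a) / (b - a))).
Proof.
move=> cH x; apply: (continuous_comp (f := fun x : R => (x - a) / (b - a))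
  (g := H)); last exact: cH.
by apply: cvgM; [apply: cvgB; [exact: cvg_id|exact: cvg_cst]|exact: cvg_cst].
Qed.

Lemma Rintegral_affine {R : realType} (a b : R) (H : R -> R) : a < b ->
  continuous H ->
  \int[lebesgue_measure]_(x in `[a, b]) H ((x - a) / (b - a)) =
  (b - a) * \int[lebesgue_measure]_(t in `[0, 1]) H t.
Proof.
move=> ab cH; have ba0 : 0 < b - a by rewrite subr_gt0.
pose F t : R := a + (b - a) * t.
have dF (x : R) : is_derive x 1 F (b - a).
  by apply: is_derive_eq; rewrite add0r mul1r; exact: mulr1.
have F'E : (F^`())%classic = cst (b - a).
  by apply/funext => x; rewrite derive1E; exact: derive_val.
have cF : continuous F.
  by move=> x; apply/differentiable_continuous/derivable1_diffP.
have F0 : F 0 = a by rewrite /F mulr0 addr0.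
have F1 : F 1 = b by rewrite /F mulr1 subrKC.
(* [G] undoes [F], so the substitution rule turns the integral of [G] over [[F 0, F 1]] into that of
   [H t * (b - a)] over [[0, 1]]. *)
pose G x := H ((x - a) / (b - a)).
have cG : continuous G by exact: continuous_rescale.
rewrite -RintegralZl//; last exact: continuous_itv_integrable.
have := @integration_by_substitution_increasing R F G 0 1.
rewrite F0 F1 F'E /Rintegral => ->//.
- congr fine; apply: eq_integral => t _; congr EFin.
  rewrite -[LHS]/(H ((F t - a) / (b - a)) * (b - a)) mulrC.
  by rewrite /F [a + _]addrC addrK [_ * t]mulrC mulfK ?gt_eqF.
- by move=> x y _ _ xy; rewrite ltrD2l ltr_pM2l.
- by move=> x _; exact: cvg_cst.
- exact: is_cvg_cst.
- exact: is_cvg_cst.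
- split => /=.
  + by move=> x _.
  + by apply: cvg_at_right_filter; exact: cF.
  + by apply: cvg_at_left_filter; exact: cF.
- exact: continuous_subspaceT.
Qed.

Lemma s_convex2_reflect_mul_le {R : realType} (a b s t : R) (f : R -> R) :
  a <= b -> (forall x, x \in `[a, b] -> 0 <= f x) -> s_convex2 s a b f ->
  0 <= t <= 1 ->
  f (a + (b - a) * t) * f (a + b - (a + (b - a) * t)) <=
  ((f a ^+ 2 + f b ^+ 2) * ((t `^ s) ^+ 2 + ((1 - t) `^ s) ^+ 2)
   + 4 * f a * f b * (t `^ s * (1 - t) `^ s)) / 2.
Proof.
move=> ab f0 fs /andP[t0 t1].
have aI : a \in `[a, b] by rewrite in_itv/= lexx.
have bI : b \in `[a, b] by rewrite in_itv/= lexx andbT.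
have t1' : 0 <= 1 - t by rewrite subr_ge0.
have bt0 : 0 <= (b - a) * t by rewrite mulr_ge0// subr_ge0.
have bt1 : 0 <= (b - a) * (1 - t) by rewrite mulr_ge0// subr_ge0.
have := fs a b (1 - t) t aI bI t1' t0 (subrK _ _).
have := fs a b t (1 - t) aI bI t0 t1' (subrKC _ _).
have -> : t * a + (1 - t) * b = a + b - (a + (b - a) * t) by ring.
have -> : (1 - t) * a + t * b = a + (b - a) * t by ring.
set x := a + (b - a) * t; have : 0 <= f x by apply: f0; rewrite in_itv/= /x; lra.
have : 0 <= f (a + b - x) by apply: f0; rewrite in_itv/= /x; lra.
move: (f x) (f (a + b - x)) (t `^ s) ((1 - t) `^ s) (f a) (f b).
move=> y z u v A B z0 y0 zle yle.
apply: (le_trans (ler_pM y0 z0 yle zle)).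
(* With P and Q the two convexity bounds, the right-hand side is (P^2 + Q^2) / 2, so its excess over
   PQ is (P - Q)^2 / 2. *)
rewrite -subr_ge0; set d := _ - _.
have -> : d = (v * A + u * B - (u * A + v * B)) ^+ 2 / 2 by rewrite /d; field.
by rewrite divr_ge0// sqr_ge0.
Qed.

(** At base 0 the exponent law can fail when the exponents cancel. Positive exponents rule this out,
    so the law also covers the endpoints t = 0 and t = 1. *)
Lemma powRDp {R : realType} (x r s : R) : 0 < r -> 0 < s ->
  x `^ (r + s) = x `^ r * x `^ s.
Proof. by move=> r0 s0; rewrite powRD// gt_eqF// addr_gt0. Qed.

Lemma powR2M {R : realType} (x s : R) : x `^ (2 * s) = (x `^ s) ^+ 2.
Proof. by rewrite mulrC powRrM powR_mulrn// powR_ge0. Qed.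

Lemma measurable_fun_reflect {R : realType} (a b : R) (f : R -> R) :
  measurable_fun `[a, b] f -> measurable_fun `[a, b] (fun x => f (a + b - x)).
Proof.
move=> mf; apply: (measurable_comp (F := `[a, b]) (f := f)) => //.
  by move=> _ [x /= + <-]; rewrite !in_itv/=; lra.
by apply: measurable_funB.
Qed.

Theorem theorem1 (R : realType) (a b : R) (f : R -> R) (s p q : R)
  (ha : 0 <= a) (hab : a < b)
  (hf0 : forall x : R, x \in `[a, b] -> 0 <= f x)
  (hfc : {within `[a, b], continuous f})
  (hfi : (@lebesgue_measure R).-integrable `[a, b] (EFin \o f))
  (hs0 : 0 < s) (hs1 : s <= 1) (hp : 0 < p) (hq : 0 < q)
  (hconv : s_convex2 s a b f) :
  \int[lebesgue_measure]_(x in `[a, b])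
     ((x - a) `^ p * (b - x) `^ q * f x * f (a + b - x))
  <= (b - a) `^ (p + q + 1) / 2 *
     ((f a ^+ 2 + f b ^+ 2) *
        (euler_beta (p + 1) (2 * s + q + 1) + euler_beta (q + 1) (2 * s + p + 1))
      + 4 * f a * f b * euler_beta (p + s + 1) (q + s + 1)).
Proof.
have ba0 : 0 < b - a by rewrite subr_gt0.
have s20 : 0 < 2 * s by rewrite mulr_gt0.
(* The three monomials obtained by multiplying t^p (1-t)^q by (1-t)^(2s), t^(2s) and t^s (1-t)^s. *)
pose K1 := @beta_kernel R p (2 * s + q).
pose K2 := @beta_kernel R (2 * s + p) q.
pose K3 := @beta_kernel R (p + s) (q + s).
have cK1 : continuous K1 by apply: beta_kernel_continuous => //; rewrite addr_gt0.
have cK2 : continuous K2 by apply: beta_kernel_continuous => //; rewrite addr_gt0.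
have cK3 : continuous K3 by apply: beta_kernel_continuous; rewrite addr_gt0.
(* The power comes from x - a = (b - a) t and b - x = (b - a)(1 - t), the 2 from the half sum of
   squares; dx will supply one more factor b - a. *)
pose c := (b - a) `^ (p + q) / 2.
pose E := f a ^+ 2 + f b ^+ 2.
pose D := 4 * f a * f b.
pose H t := c * (E * (K1 t + K2 t) + D * K3 t).
have cM (k : R) (h : R -> R) : continuous h -> continuous (fun t => k * h t).
  by move=> ch t; apply: cvgMr; exact: ch.
have cD (g h : R -> R) : continuous g -> continuous h ->
    continuous (fun t => g t + h t).
  by move=> cg ch t; apply: cvgD; [exact: cg|exact: ch].
have cK12 := cD _ _ cK1 cK2.
have cEK := cM E _ cK12.
have cDK := cM D _ cK3.
have cH' := cD _ _ cEK cDK.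
have cH : continuous H := cM c _ cH'.
have intH : \int[lebesgue_measure]_(x in `[a, b]) H ((x - a) / (b - a)) =
    (b - a) `^ (p + q + 1) / 2 *
     ((f a ^+ 2 + f b ^+ 2) *
        (euler_beta (p + 1) (2 * s + q + 1) + euler_beta (q + 1) (2 * s + p + 1))
      + 4 * f a * f b * euler_beta (p + s + 1) (q + s + 1)).
  rewrite Rintegral_affine// /H.
  rewrite RintegralZl//; last exact: continuous_itv_integrable.
  rewrite RintegralD//; [|exact: continuous_itv_integrable..].
  rewrite !RintegralZl//; [|exact: continuous_itv_integrable..].
  rewrite RintegralD//; [|exact: continuous_itv_integrable..].
  (* [K2] yields its Beta value with the arguments in the opposite order to the goal. *)
  rewrite !Rintegral_beta_kernel [euler_beta (2 * s + p + 1) _]euler_betaC;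
    [|by rewrite ltrDr// addr_gt0..].
  by rewrite [(b - a) `^ (_ + 1)]powRDp ?addr_gt0// powRr1 1?ltW// /c /E /D; ring.
(* The lower bound 0 lets the same estimate serve as a domination in absolute value. *)
have leH x : x \in `[a, b] -> 0 <= (x - a) `^ p * (b - x) `^ q * f x * f (a + b - x)
    <= H ((x - a) / (b - a)).
  move=> xab; have := xab; rewrite in_itv/= => /andP[ax xb].
  set t := (x - a) / (b - a).
  have xE : x = a + (b - a) * t by rewrite /t mulrC divfK ?gt_eqF// subrKC.
  have t01 : 0 <= t <= 1.
    by rewrite divr_ge0 ?subr_ge0 ?(ltW hab)//= ler_pdivrMr// mul1r lerD2r.
  have /andP[t0 t1] := t01.
  rewrite !mulr_ge0 ?powR_ge0 ?hf0//=; last by rewrite in_itv/=; lra.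
  rewrite -mulrA.
  have -> : (x - a) `^ p = (b - a) `^ p * t `^ p.
    by rewrite -powRM// ?(ltW ba0)// {1}xE addrAC subrr add0r.
  have -> : (b - x) `^ q = (b - a) `^ q * (1 - t) `^ q.
    rewrite -powRM ?subr_ge0 ?(ltW hab)//.
    by congr (_ `^ _); rewrite {1}xE; ring.
  rewrite /H /K1 /K2 /K3 !beta_kernelE//.
  rewrite /c !powRDp// !powR2M.
  have := s_convex2_reflect_mul_le _ _ _ _ _ (ltW hab) hf0 hconv t01.
  rewrite -xE.
  set W := (b - a) `^ p * t `^ p * ((b - a) `^ q * (1 - t) `^ q).
  have W0 : 0 <= W by rewrite /W !mulr_ge0 ?powR_ge0.
  move=> /(ler_wpM2l W0) /le_trans; apply.
  (* After weighting by [W], the pointwise bound is exactly [H t], so only an identity remains. *)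
  by rewrite le_eqVlt; apply/orP; left; apply/eqP; rewrite /W /E /D; field.
have iG : (@lebesgue_measure R).-integrable `[a, b]
    (EFin \o (fun x => H ((x - a) / (b - a)))).
  exact/continuous_itv_integrable/continuous_rescale.
rewrite -intH; apply: le_Rintegral => //; last first.
  by move=> x /leH/andP[].
(* Monotonicity of the integral needs the integrand integrable: it is measurable and dominated by
   the rescaled [H]. *)
apply: le_integrable iG => //.
  apply/measurable_EFinP.
  have mf : measurable_fun `[a, b] f.
    by apply/measurable_EFinP; case/integrableP: hfi.
  apply: measurable_funM; last exact: measurable_fun_reflect.
  apply: measurable_funM => //; apply: measurable_funM.
    by apply: (measurableT_comp (measurable_powR p)); apply: measurable_funB.
  by apply: (measurableT_comp (measurable_powR q)); apply: measurable_funB.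
move=> x /leH /andP[l0 lH] /=.
by rewrite lee_fin !ger0_norm// (le_trans l0 lH).
Qed.
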